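(* Let $\{a_1(n),\dots,a_s(n)\}$, $n\in\mathbb{N}$, be a finite family of sequences of positive integers and put $a_\ell(0)=0$ for all $\ell=1,\dots,s$. If for any finite set $F\subset\mathbb{N}\cup\{0\}$ the family of sequences $$\big\{n\mapsto a_\ell(n+h)-a_1(n)-a_\ell(h)\ \big|\ h\in F,\ \ell\in\{1,\dots,s\}\big\}$$ is a family of multiple IP topological recurrence, then so is the family $\{a_1(n),\dots,a_s(n)\}$, $n\in\mathbb{N}$.
   Context: $\mathbb{N}=\{1,2,\dots\}$; $\mathcal{F}$ is the family of all finite non-empty subsets of $\mathbb{N}$. Given an increasing sequence $(n_k)_{k\in\mathbb{N}}$ in $\mathbb{N}$, the IP-set generated by it is (the image of) the map $\mathcal{F}\to\mathbb{N}$, $\alpha\mapsto n_\alpha=\sum_{k\in\alpha}n_k$. A topological dynamical system is a pair $(X,T)$ with $X$ a (non-empty) compact Hausdorff space and $T:X\to X$ a homeomorphism; it is minimal if there is no non-empty proper compact subset $Y\subset X$ with $T^{-1}Y\subset Y$. A family of sequences of integers $\{b_1(n),\dots,b_k(n)\}$ ($n\in\mathbb{N}$) is a family of multiple IP topological recurrence if for any minimal system $(X,T)$, any non-empty open set $U\subset X$ and any IP-set $(n_\alpha)_{\alpha\in\mathcal{F}}$, there exists $\alpha\in\mathcal{F}$ such that $U\cap T^{-b_1(n_\alpha)}U\cap\cdots\cap T^{-b_k(n_\alpha)}U\neq\varnothing$. *)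

(* Defs.v *)
From mathcomp Require Import all_boot all_order all_algebra finmap.
From mathcomp Require Import boolp classical_sets functions topology.

Set Implicit Arguments.
Unset Strict Implicit.
Unset Printing Implicit Defensive.

Local Open Scope classical_set_scope.

(* [nat] contains 0, so positivity of the generators is required separately.
   Generators are indexed from 0 rather than 1: [m k] is the (k+1)-st one. *)
Definition IP_generator (m : nat -> nat) : Prop :=
  (forall k, (0 < m k)%N) /\ {homo m : i j / (i < j)%N}.

Definition IP_sum (m : nat -> nat) (alpha : {fset nat}) : nat :=
  (\sum_(k <- alpha) m k)%N.

Definition is_homeomorphism (X : topologicalType) (T : X -> X) : Prop :=
  continuous T /\
  exists S : X -> X, [/\ continuous S, cancel T S & cancel S T].

Definition top_dyn_system (X : topologicalType) (T : X -> X) : Prop :=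
  [/\ [set: X] !=set0, compact [set: X], hausdorff_space X
    & is_homeomorphism T].

Definition minimal_system (X : topologicalType) (T : X -> X) : Prop :=
  top_dyn_system T /\
  ~ exists Y : set X,
      [/\ compact Y, Y !=set0, Y != [set: X] & T @^-1` Y `<=` Y].

(* T^{-z} U for an integer z, T being a bijection: if z = - n.+1 is negative
   then T^{-z} U = T^{n+1} U is a forward image. *)
Definition pullback_iter (X : Type) (T : X -> X) (z : int) (U : set X) :
    set X :=
  match z with
  | Posz n => iter n T @^-1` U
  | Negz n => iter n.+1 T @` U
  end.

(* Only the values [b i n] with n > 0 matter, because [IP_sum m alpha] is
   positive. *)
Definition multiple_IP_top_recurrence (I : finType) (b : I -> nat -> int) :
    Prop :=
  forall (X : topologicalType) (T : X -> X), minimal_system T ->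
  forall U : set X, open U -> U !=set0 ->
  forall m : nat -> nat, IP_generator m ->
  exists2 alpha : {fset nat}, alpha != fset0%fset &
    (U `&` \bigcap_(i in [set: I])
             pullback_iter T (b i (IP_sum m alpha)) U) !=set0.

(* Main.v *)
Require Import Defs.
From mathcomp Require Import all_boot all_order all_algebra finmap.
From mathcomp Require Import boolp classical_sets functions topology.
From HB Require Import structures.
From mathcomp Require Import zify.

(** The proof is a colouring argument along a tower of returns.  Let [S] be
    the inverse of [T].  By minimality and compactness finitely many sets
    [S^-c U] cover [X]; call [c] a colour of [x] when [S^c x] lies in [U].

    Call a point [x] good for a set [C] of colours, with finite index sets
    [beta c] for [c] in [C], when [T^(a_l(n_(beta c))) x] has colour [c] for
    all [c] in [C] and all [l].  Good points form an open set ([towers_open]).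
    If it is non-empty, the recurrence hypothesis for
    [F = {n_(beta c) | c in C}] and an IP-set supported beyond all the
    [beta c] gives [n = n_alpha] and a point [y] such that, for all [c] and
    [l], the translate of [y] by
    [a_l(n + n_(beta c)) - a_1(n) - a_l(n_(beta c))] is good.  Then
    [x = T^(- a_1(n)) y] is good for the enlarged index sets
    [beta c `|` alpha], because [T^(a_l(n + h)) x] is the image under
    [T^(a_l(h))] of a good point, where [h = n_(beta c)]
    ([towers_extend]).

    Now let [c] be a colour of [x].  If [c] is in [C], then [S^c x] and all
    its translates by [a_l(n_(beta c `|` alpha))] lie in [U], which is the
    desired recurrence.  Otherwise [x] is good for [c |` C], with the empty
    index set attached to [c], since [a_l(0) = 0].  As there are only finitely
    many colours, the second case cannot occur forever. *)

Local Open Scope classical_set_scope.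

(** Minimality forbids non-trivial closed sets stable under backward images;
    hence the cover uses the iterates of the inverse of [T], as the set of
    points whose backward orbit avoids [U] is of that kind. *)
Lemma minimal_backward_cover (X : topologicalType) (T S : X -> X) (U : set X) :
  minimal_system T -> continuous S -> cancel T S -> open U -> U !=set0 ->
  exists D : {fset nat}, forall x, exists2 c, c \in D & U (iter c S x).
Proof.
move=> [[[x0 _] cX _ _] minT] cS TK Uo [u0 Uu0].
have itero c : open (iter c S @^-1` U).
  elim: c => [//|c IH].
  have -> : iter c.+1 S @^-1` U = S @^-1` (iter c S @^-1` U).
    by apply/seteqP; split => x; rewrite /preimage/= -iterS iterSr.
  by move/continuousP : cS; apply.
have cover_all x : exists c, U (iter c S x).
  apply: contrapT => xN; apply: minT.
  pose Y := ~` \bigcup_(c in setT) (iter c S @^-1` U).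
  exists Y; split.
  - apply: (@subclosed_compact _ _ setT) => //.
    by apply: open_closedC; apply: bigcup_open.
  - by exists x => -[c _ Uc]; apply: xN; exists c.
  - apply/eqP => YT; have : Y u0 by rewrite YT.
    by apply; exists 0%N.
  - move=> y YTy [c _ Uc]; apply: YTy; exists c.+1 => //.
    by rewrite /preimage/= -iterS iterSr TK.
(* The finite subcover property is stated for pointed spaces. *)
pose Xp : ptopologicalType := HB.pack X (isPointed.Build X x0).
have cXp : @compact Xp setT := cX.
rewrite compact_cover in cXp.
have [D _ subD] := cXp nat setT (fun c => iter c S @^-1` U) (fun c _ => itero c)
  (fun x _ => let: ex_intro c Uc := cover_all x in ex_intro2 _ _ c I Uc).
by exists D => x; have [c cD Uc] := subD x I; exists c.
Qed.

Lemma pullback_iter_sub {X : Type} {T : X -> X} {p q : nat} {U : set X} {y} :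
  pullback_iter T (Posz p - Posz q)%R U y ->
  exists2 v, U v & iter p T y = iter q T v.
Proof.
have [qp|pq] := leqP q p.
  have -> : (Posz p - Posz q)%R = Posz (p - q) by lia.
  move=> Uv; exists (iter (p - q) T y) => //.
  by rewrite -iterD subnKC.
have -> : (Posz p - Posz q)%R = Negz (q - p).-1 by lia.
case=> v Uv <-; exists v => //.
by rewrite -iterD; congr iter; lia.
Qed.

Lemma fset_bounded (A : {fset nat}) : exists N, forall k, k \in A -> (k < N)%N.
Proof.
exists (\max_(k <- A) k).+1 => k kA.
by rewrite ltnS; apply: leq_bigmax_seq.
Qed.

Lemma IP_sum0 m : IP_sum m fset0 = 0%N.
Proof. by rewrite /IP_sum big_nil. Qed.

Lemma IP_sumU m (A B : {fset nat}) : [disjoint A & B]%fset ->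
  IP_sum m (A `|` B)%fset = (IP_sum m A + IP_sum m B)%N.
Proof.
move=> /fdisjointP dAB; rewrite /IP_sum (big_fsetID _ (mem A)) /=.
congr addn; apply: congr_big => //; congr enum_fset; apply/fsetP => i.
  by rewrite !inE /=; case: (i \in A); rewrite ?andbF.
rewrite !inE /=; have := dAB i; case: (i \in A) => /= [/(_ isT)/negPf->|_] //.
by rewrite andbT.
Qed.

Lemma IP_sum_shift m (N : nat) (A : {fset nat}) :
  IP_sum (fun k => m (k + N)%N) A = IP_sum m [fset (k + N)%N | k in A]%fset.
Proof. by rewrite /IP_sum big_imfset //= => i j _ _ /addIn. Qed.

(** Recurrence times may be sought beyond any given bound, since the tail of
    a generating sequence generates an IP-set. *)
Lemma recurrence_beyond {I : finType} {b : I -> nat -> int}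
    (b_rec : multiple_IP_top_recurrence b) (N : nat)
    {X : topologicalType} {T : X -> X} (minT : minimal_system T)
    {U : set X} (Uo : open U) (U0 : U !=set0)
    {m : nat -> nat} (m_gen : IP_generator m) :
  exists alpha : {fset nat}, [/\ alpha != fset0,
    forall k, k \in alpha -> (N <= k)%N
    & exists y, forall i, pullback_iter T (b i (IP_sum m alpha)) U y].
Proof.
have gen' : IP_generator (fun k => m (k + N)%N).
  case: m_gen => m0 m_incr; split => // i j ij.
  by apply: m_incr; rewrite ltn_add2r.
have [A A0 [y [_ Hy]]] := b_rec X T minT U Uo U0 _ gen'.
exists [fset (k + N)%N | k in A]%fset; split.
- have [k kA] := fset0Pn _ A0.
  by apply/fset0Pn; exists (k + N)%N; apply/imfsetP; exists k.
- by move=> _ /imfsetP[k _ ->]; rewrite leq_addl.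
- by exists y => i; rewrite -IP_sum_shift; apply: Hy.
Qed.

Section Towers.
Context {X : topologicalType} {I : finType}.
Variables (T S : X -> X) (U : set X) (a : I -> nat -> nat) (m : nat -> nat).

(** The points called good in the introduction: [beta c] is the index set
    leading to colour [c]. *)
Definition towers (C : {fset nat}) (beta : nat -> {fset nat}) : set X :=
  [set x | forall c l, c \in C ->
     U (iter c S (iter (a l (IP_sum m (beta c))) T x))].

Lemma towers_open C beta :
  continuous T -> continuous S -> open U -> open (towers C beta).
Proof.
move=> cT cS Uo.
have itero (f : X -> X) n V : continuous f -> open V -> open (iter n f @^-1` V).
  move=> cf Vo; elim: n => [//|n IH].
  have -> : iter n.+1 f @^-1` V = f @^-1` (iter n f @^-1` V).
    by apply/seteqP; split => x; rewrite /preimage/= -iterS iterSr.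
  by move/continuousP : cf; apply.
pose V c l := iter (a l (IP_sum m (beta c))) T @^-1` (iter c S @^-1` U).
rewrite openE => x xtow; rewrite /interior.
have : nbhs x (\bigcap_(c in [set` C]) [set y | forall l, V c l y]).
  apply: filter_bigI => c cC; apply: filter_forall => l.
  apply: open_nbhs_nbhs; split; last exact: xtow.
  by apply: (itero _ _ _ cT); apply: itero.
by apply: filterS => y yV c l cC; exact: yV.
Qed.

End Towers.

(** The recurrence hypothesis is applied to the open set of good points itself;
    the point found there is then moved by [- a_1(n)], which turns each
    exponent [a_l(n + h) - a_1(n) - a_l(h)] into [a_l(n + h) - a_l(h)]. *)
Lemma towers_extend (s : nat) (a : 'I_s.+1 -> nat -> nat)
    (a_rec : forall F : {fset nat},
       multiple_IP_top_recurrence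
         (fun (hl : F * 'I_s.+1) (n : nat) =>
            (Posz (a hl.2 (n + val hl.1)%N) - Posz (a ord0 n)
               - Posz (a hl.2 (val hl.1)))%R))
    {X : topologicalType} {T S : X -> X} {U : set X} {m : nat -> nat} C beta :
  minimal_system T -> continuous T -> continuous S ->
  cancel T S -> cancel S T -> open U -> IP_generator m ->
  towers T S U a m C beta !=set0 ->
  exists2 alpha : {fset nat}, alpha != fset0 &
    towers T S U a m C (fun c => beta c `|` alpha)%fset !=set0.
Proof.
move=> minT cT cS TK SK Uo m_gen tow0.
have [N ltN] := fset_bounded (\bigcup_(c <- C) beta c)%fset.
pose F := [fset IP_sum m (beta c) | c in C]%fset.
have [alpha [alpha0 leN [y Hy]]] :=
  recurrence_beyond (a_rec F) N minT (towers_open T S U a m C beta cT cS Uo)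
    tow0 m_gen.
exists alpha => //; set n := IP_sum m alpha in Hy.
exists (iter (a ord0 n) S y) => c l cC.
have hF : IP_sum m (beta c) \in F by apply/imfsetP; exists c.
have {Hy} := Hy (FSetSub hF, l); set h := IP_sum m (beta c) => /=.
have -> : IP_sum m (beta c `|` alpha)%fset = (n + h)%N.
  rewrite IP_sumU 1?addnC //; apply/fdisjointP => k kb; apply/negP => /leN.
  by rewrite leqNgt ltN //; apply/bigfcupP; exists c => //; rewrite cC.
have -> : (Posz (a l (n + h)%N) - Posz (a ord0 n) - Posz (a l h) =
  Posz (a l (n + h)%N) - Posz (a ord0 n + a l h)%N)%R by lia.
move=> /pullback_iter_sub[v vtow yv].
have -> : iter (a l (n + h)%N) T (iter (a ord0 n) S y) = iter (a l h) T v.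
  have iterK (f g : X -> X) k : cancel f g -> cancel (iter k f) (iter k g).
    by move=> fK; elim: k => [//|k IH] z; rewrite iterSr /= fK.
  apply: (can_inj (iterK _ _ (a ord0 n) TK)).
  by rewrite -!iterD -yv addnC iterD iterK.
exact: vtow.
Qed.

Theorem lemma8p5 (s : nat) (a : 'I_s.+1 -> nat -> nat)
    (a_pos : forall l n, (0 < n)%N -> (0 < a l n)%N)
    (a_0 : forall l, a l 0%N = 0%N)
    (a_rec : forall F : {fset nat},
       multiple_IP_top_recurrence
         (fun (hl : F * 'I_s.+1) (n : nat) =>
            (Posz (a hl.2 (n + val hl.1)%N) - Posz (a ord0 n)
               - Posz (a hl.2 (val hl.1)))%R)) :
  multiple_IP_top_recurrence (fun (l : 'I_s.+1) (n : nat) => Posz (a l n)).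
Proof.
move=> X T minT U Uo U0 m m_gen; apply: contrapT => nrec.
have [[[x0 _] _ _ [cT [S [cS TK SK]]]] _] := minT.
have [D coverD] := minimal_backward_cover X T S U minT cS TK Uo U0.
have comm k c x : iter c S (iter k T x) = iter k T (iter c S x).
  elim: c => [//|c IH] /=; rewrite {}IH; move: (iter c S x) => z.
  by elim: k => [//|k IH] /=; rewrite TK -IH SK.
(* More colours than [D] has cannot be reached. *)
suff [C [beta [CD sizeC _]]] : exists C beta,
    [/\ (C `<=` D)%fset, #|` C| = #|` D|.+1 & towers T S U a m C beta !=set0].
  by have := fsubset_leq_card CD; rewrite sizeC ltnn.
elim: (#|` D|.+1) => [|k [C [beta [CD sizeC tow0]]]].
  by exists fset0, (fun=> fset0); split; rewrite ?fsub0set ?cardfs0 //; exists x0.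
have [alpha alpha0 [x xtow]] :=
  towers_extend s a a_rec C beta minT cT cS TK SK Uo m_gen tow0.
have [c cD Uc] := coverD x.
(* Either the colour [c] repeats, giving the return, or it is new. *)
have [cC|cC] := boolP (c \in C).
  case: nrec; exists (beta c `|` alpha)%fset.
    have [i ia] := fset0Pn _ alpha0.
    by apply/fset0Pn; exists i; rewrite inE ia orbT.
  exists (iter c S x); split => // l _ /=.
  by rewrite /preimage /= -comm; exact: xtow.
exists (c |` C)%fset,
  (fun d => if d == c then fset0 else beta d `|` alpha)%fset; split.
- by rewrite fsubUset fsub1set cD.
- by rewrite cardfsU1 cC sizeC.
- exists x => d l; rewrite in_fset1U; case: eqP => [->|_ /= dC].
    by rewrite IP_sum0 a_0.
  exact: xtow.
Qed.
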